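(* Let ${\cal F}=([n],E)$ be a $d$-uniform hypergraph, and let $v$ be a positive integer with $v<d\leq \frac{3v}{2c}$, where $c$ is a constant in $[1,3/2)$. Then the minimum length of an $E$-separable code is at least $$\frac{v}{c(d-v/c)\log\left(\frac{ev}{c(d-v/c)}\right)}\,\log\left(\frac{|E|}{n^{v/c}}\right).$$
   Context: A hypergraph ${\cal F}=([n],E)$ consists of the vertex set $[n]=\{1,\ldots,n\}$ and a family $E$ of subsets of $[n]$ (hyperedges); it is $d$-uniform if every hyperedge has exactly $d$ vertices. For a $t\times n$ binary matrix $M$ with columns $c_1,\ldots,c_n$, $M$ is an $E$-separable code if for any two distinct hyperedges $e,e'\in E$ one has $\bigvee_{j\in e}c_j\neq\bigvee_{j\in e'}c_j$ (bitwise OR of columns); $t$ is its length. Logarithms are base 2, and $e=2.718\ldots$ is the base of the natural logarithm. *)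

(* Defs.v *)
From HB Require Import structures.
From mathcomp Require Import all_boot all_order all_algebra.
From mathcomp Require Import all_classical all_reals all_analysis.

Set Implicit Arguments.
Unset Strict Implicit.
Unset Printing Implicit Defensive.

Import Order.TTheory GRing.Theory Num.Theory.

Local Open Scope ring_scope.

(* A hypergraph on [n] is given by its set of hyperedges, with the vertex set
   {1, ..., n} encoded as 'I_n. *)
Definition uniform_hypergraph (n d : nat) (E : {set {set 'I_n}}) : Prop :=
  forall e : {set 'I_n}, e \in E -> #|e| = d.

Definition or_columns (t n : nat) (M : 'M[bool]_(t, n)) (e : {set 'I_n}) :
    'cV[bool]_t :=
  \col_i \big[orb/false]_(j in e) M i j.

Definition separable_code (n : nat) (E : {set {set 'I_n}}) (t : nat)
    (M : 'M[bool]_(t, n)) : bool :=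
  [forall e in E, forall e' in E, (e != e') ==> 
     (or_columns M e != or_columns M e')].

Lemma separable_codeP (n : nat) (E : {set {set 'I_n}}) (t : nat)
    (M : 'M[bool]_(t, n)) :
  reflect (forall e e' : {set 'I_n}, e \in E -> e' \in E -> e <> e' ->
             or_columns M e <> or_columns M e')
          (separable_code E M).
Proof.
apply: (iffP idP) => [/forall_inP sepM e e' Ee Ee' /eqP nee'|sepM].
  by apply/eqP; move/forall_inP/(_ e' Ee')/implyP: (sepM e Ee); apply.
apply/forall_inP => e Ee; apply/forall_inP => e' Ee'; apply/implyP => /eqP nee'.
by apply/eqP; apply: sepM.
Qed.

(* The identity matrix is a separable code of length n. *)
Lemma ex_separable_code (n : nat) (E : {set {set 'I_n}}) :
  exists t : nat, [exists M : 'M[bool]_(t, n), separable_code E M].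
Proof.
exists n; apply/existsP; exists (\matrix_(i, j) (i == j)).
apply/separable_codeP => e e' _ _ nee' eqe; apply: nee'.
have orE (f : {set 'I_n}) (i : 'I_n) :
    or_columns (\matrix_(i, j) (i == j)) f i ord0 = (i \in f).
  rewrite mxE big_orE; apply/exists_inP/idP => [[j fj]|fi].
    by rewrite mxE => /eqP ->.
  by exists i => //; rewrite mxE.
by apply/setP => i; rewrite -!orE eqe.
Qed.

Definition min_separable_length (n : nat) (E : {set {set 'I_n}}) : nat :=
  ex_minn (ex_separable_code E).

(* As ln x = 0 for x <= 0, log2 0 = 0: this is the value used when E is empty. *)
Definition log2 (R : realType) (x : R) : R := ln x / ln 2.

(* Main.v *)
Require Import Defs.
From HB Require Import structures.
From mathcomp Require Import all_boot all_order all_algebra.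
From mathcomp Require Import all_classical all_reals all_analysis.
From mathcomp Require Import ring lra.

Import Order.TTheory GRing.Theory Num.Theory.
Local Open Scope ring_scope.

(** Write [x = v / c] and let [t] be the length of a separable code. Two
    elementary counts hold: [|E| <= 2 ^ t], as distinct hyperedges have distinct
    unions, and [|E| <= 'C(n, d) <= n ^ d]. Interpolating them with weights
    [(d - x) / d] and [x / d] gives
    [log2 (|E| / n ^ x) <= (d - x) / d * t]. This is stronger than the claim:
    [x <= d], and [d <= 3 x / 2] means [x / (d - x) >= 2], so that
    [log2 (e x / (d - x)) >= 1]. *)

Lemma card_separable_le (n t : nat) (E : {set {set 'I_n}})
    (M : 'M[bool]_(t, n)) :
  separable_code E M -> (#|E| <= 2 ^ t)%N.
Proof.
move=> /separable_codeP sepM.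
have inj : {in E &, injective (or_columns M)}.
  move=> e e' Ee Ee' eqe; apply/eqP/negPn/negP => /eqP nee'.
  exact: (sepM e e' Ee Ee' nee' eqe).
rewrite -(card_in_imset inj); apply: (leq_trans (max_card _)).
by rewrite card_mx card_bool muln1.
Qed.

Lemma card_le_min_separable (n : nat) (E : {set {set 'I_n}}) :
  (#|E| <= 2 ^ min_separable_length E)%N.
Proof.
rewrite /min_separable_length; case: ex_minnP => t /existsP[M sepM] _.
exact: card_separable_le sepM.
Qed.

Lemma bin_le_expn (n d : nat) : ('C(n, d) <= n ^ d)%N.
Proof.
(* The falling factorial [n ^_ d] is ['C(n, d)] times [d!], and each of its [d] factors is at most
   [n]. *)
apply: (@leq_trans (n ^_ d)); first by rewrite -bin_ffact leq_pmulr ?fact_gt0.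
elim: d => // d IHd; rewrite ffactnSr expnSr.
by apply: leq_mul; rewrite ?leq_subr.
Qed.

Lemma card_uniform_le (n d : nat) (E : {set {set 'I_n}}) :
  uniform_hypergraph d E -> (#|E| <= n ^ d)%N.
Proof.
move=> Ed; apply: leq_trans (bin_le_expn n d).
rewrite -[in leqRHS](card_ord n) -card_draws; apply/subset_leq_card/fintype.subsetP.
by move=> e Ee; rewrite inE Ed.
Qed.

(** Puts both counts in logarithmic form: [b = 2] for the code length, [b = n] for the edge size. *)
Lemma ln_natr_leX (R : realType) (m b k : nat) :
  (0 < m)%N -> (0 < b)%N -> (m <= b ^ k)%N -> ln m%:R <= k%:R * ln b%:R :> R.
Proof.
move=> m_gt0 b_gt0 le_mbk.
by rewrite mulr_natl -lnXn ?ltr0n // -natrX ler_ln ?posrE ?ltr0n ?expn_gt0 ?b_gt0 // ler_nat.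
Qed.

Theorem theorem1 (R : realType) (n d v : nat) (c : R) (E : {set {set 'I_n}})
    (Ed : uniform_hypergraph d E) (v_gt0 : (0 < v)%N) (c_ge1 : 1 <= c) (c_lt : c < 3 / 2)
    (v_lt_d : (v < d)%N) (d_le : d%:R <= 3 * v%:R / (2 * c)) :
  v%:R / (c * (d%:R - v%:R / c)
            * log2 (expR 1 * v%:R / (c * (d%:R - v%:R / c))))
    * log2 (#|E|%:R / n%:R `^ (v%:R / c))
  <= (min_separable_length E)%:R.
Proof.
(* For empty [E] the convention [ln 0 = 0] makes the left side 0. *)
have [->|E_gt0] := posnP #|E|.
  by rewrite mulr0n mul0r /log2 (ln0 (lexx 0)) mul0r mulr0 ler0n.
have n_gt0 : (0 < n)%N.
  have := leq_trans E_gt0 (card_uniform_le n d E Ed).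
  by rewrite expn_gt0 => /orP[//|/eqP d0]; rewrite d0 in v_lt_d.
have le2t := ln_natr_leX R _ 2 _ E_gt0 isT (card_le_min_separable n E).
have lend := ln_natr_leX R _ _ _ E_gt0 n_gt0 (card_uniform_le n d E Ed).
have c_gt0 : 0 < c by lra.
have vR_gt0 : 0 < v%:R :> R by rewrite ltr0n.
have vdR : v%:R < d%:R :> R by rewrite ltr_nat.
have ln2_gt0 : 0 < ln 2 :> R by rewrite ln_gt0 // ltr1n.
have nR_gt0 : 0 < n%:R :> R by rewrite ltr0n.
rewrite /log2 [ln (#|E|%:R / _)]ln_div ?posrE ?ltr0n ?powR_gt0 // ln_powR.
set t := (min_separable_length E)%:R : R in le2t *.
have t_ge0 : 0 <= t by rewrite ler0n.
set L := ln #|E|%:R in le2t lend *; set N := ln n%:R in lend *.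
set x := v%:R / c.
have x_gt0 : 0 < x by rewrite divr_gt0.
have vE : v%:R = c * x by rewrite /x; field; rewrite gt_eqF.
(* With [v < d] this gives [x < d], hence [a > 0] below. *)
have le_xv : x <= v%:R by rewrite ler_pdivrMr // ler_peMr // ltW.
have le_d3x : d%:R <= 3 / 2 * x.
  suff <- : 3 * v%:R / (2 * c) = 3 / 2 * x by [].
  by rewrite /x; field; rewrite gt_eqF.
set a := d%:R - x; have a_gt0 : 0 < a by rewrite /a; lra.
rewrite vE; set y := expR 1 * (c * x) / (c * a).
have y_ge2 : 2 <= y.
  have -> : y = expR 1 * (x / a) by rewrite /y; field; rewrite !gt_eqF.
  have e_ge1 : 1 <= expR 1 :> R by rewrite -expR0 ler_expR.
  (* From [d <= 3 / 2 * x] one gets [a <= x / 2]. *)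
  have xa_ge2 : 2 <= x / a by rewrite ler_pdivlMr // /a; lra.
  by apply: le_trans xa_ge2 _; rewrite ler_peMl // divr_ge0 ?ltW.
have le_ln2y : ln 2 <= ln y by rewrite ler_ln ?posrE // (lt_le_trans _ y_ge2).
have lny_gt0 : 0 < ln y by exact: lt_le_trans le_ln2y.
(* Both [c] and [ln 2] cancel, so the claim no longer depends on the base of the logarithm. *)
have -> : c * x / (c * a * (ln y / ln 2)) * ((L - x * N) / ln 2)
          = x * (L - x * N) / (a * ln y).
  by field; rewrite !gt_eqF.
rewrite ler_pdivrMr ?mulr_gt0 //.
(* The interpolation, scaled by [d]: the weights [a] and [x] sum to [d], and the term [x * (d * N)]
   cancels. *)
have bound_d : d%:R * (L - x * N) <= t * (a * ln 2).
  have h1 := ler_wpM2l (ltW a_gt0) le2t.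
  have h2 := ler_wpM2l (ltW x_gt0) lend.
  have -> : d%:R * (L - x * N) = a * L + x * L - x * (d%:R * N) by rewrite /a; ring.
  have -> : t * (a * ln 2) = a * (t * ln 2) by ring.
  lra.
have le_rhs : t * (a * ln 2) <= t * (a * ln y).
  by apply: ler_wpM2l => //; apply: ler_wpM2l => //; exact: ltW.
(* Replacing the factor [d] by the smaller [x] is sound only when [L - x * N] is nonnegative;
   otherwise the left side is at most 0 and the right side at least 0. *)
have [LxN_ge0|LxN_lt0] := leP 0 (L - x * N).
  apply: le_trans (le_trans bound_d le_rhs).
  by apply: ler_wpM2r => //; lra.
apply: (@le_trans _ _ 0); first by rewrite pmulr_rle0 // ltW.
by rewrite !mulr_ge0 // ltW.
Qed.
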